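(* Let $1\le p\le\infty$, $E=\mathcal{L}^p(I)$, and let $F,F',B,B'\subset E$ be nonempty compact sets with bounds $M_F,M_{F'},M_B,M_{B'}$ respectively (e.g. $\|g\|_p\le M_F$ for all $g\in F$). Then for any $f,b\in E$: $d_{\mathcal H}(F,F*_Tb)\le\frac{\Lambda}{1-\Lambda}(M_F+\|b\|_p)$; $d_{\mathcal H}(B,f*_TB)\le\frac{1}{1-\Lambda}(M_B+\|f\|_p)$; $d_{\mathcal H}(F,F*_TB)\le\frac{\Lambda}{1-\Lambda}(M_F+M_B)$; $d_{\mathcal H}(B,F*_TB)\le\frac{1}{1-\Lambda}(M_B+M_F)$; $d_{\mathcal H}(F*_TB,F'*_TB)\le\frac{1}{1-\Lambda}(M_F+M_{F'})$; $d_{\mathcal H}(F*_TB,F*_TB')\le\frac{\Lambda}{1-\Lambda}(M_B+M_{B'})$; $d_{\mathcal H}(F*_TB,F'*_TB')\le\frac{1}{1-\Lambda}\big((M_F+M_{F'})+\Lambda(M_B+M_{B'})\big)$. For $0<p<1$ the same holds when $\|g\|_p$ is interpreted as $\int_I|g|^p\,dx$ and $\Lambda$ is replaced by $\Lambda^p$.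
   Context: Let $N\ge 2$, $I=[x_0,x_N]$, $\Delta: x_0<\dots<x_N$ a partition, $L_n(x)=a_nx+b_n$ affine with $L_n(x_0)=x_{n-1}$, $L_n(x_N)=x_n$, $I_1=[x_0,x_1]$, $I_n=(x_{n-1},x_n]$ for $n\ge2$, and $\alpha=(\alpha_1,\dots,\alpha_N)\in(\mathcal{L}^\infty(I))^N$ with $\Lambda:=\operatorname{ess\,sup}\{|\alpha_n(x)|:x\in I,n=1,\dots,N\}<1$. For $f,b\in\mathcal{L}^p(I)$, $f*_Tb$ is the unique fixed point in $\mathcal{L}^p(I)$ of the contraction $Tg(x):=f(x)+\alpha_n(L_n^{-1}(x))(g-b)(L_n^{-1}(x))$, $x\in I_n$. For sets: $F*_Tb:=\{f*_Tb:f\in F\}$, $f*_TB:=\{f*_Tb:b\in B\}$, $F*_TB:=\{f*_Tb: f\in F, b\in B\}$. $\delta(x,K):=\inf_{y\in K}\|x-y\|_p$ and the Hausdorff distance is $d_{\mathcal H}(H,K):=\max\{\sup_{x\in H}\delta(x,K),\sup_{y\in K}\delta(y,H)\}$. *)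

(* Defs.v *)
From HB Require Import structures.
From mathcomp Require Import all_boot all_order all_algebra.
From mathcomp Require Import all_classical all_reals all_analysis.
Import Order.TTheory GRing.Theory Num.Theory.

Set Implicit Arguments.
Unset Strict Implicit.
Unset Printing Implicit Defensive.

Local Open Scope classical_set_scope.
Local Open Scope ring_scope.

Section FractalDefs.
Variable R : realType.

(* The interval I = [x_0, x_N] of the partition x : nat -> R with N+1 nodes. *)
Definition Iset (x : nat -> R) (N : nat) : set R := `[x 0%N, x N].

Definition muI (x : nat -> R) (N : nat) :=
  mrestr (@lebesgue_measure R) (measurable_itv `[x 0%N, x N]).

(* "Norm" used in the paper: the L^p norm for 1 <= p <= oo, and
   int_I |g|^p dx for 0 < p < 1. (-oo is junk, excluded by hypotheses.) *)
Definition pnorm (x : nat -> R) (N : nat) (p : \bar R) (g : R -> R) : \bar R :=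
  match p with
  | r%:E => if (1 <= r)%R then Lnorm (muI x N) p (EFin \o g)
            else (\int[muI x N]_t (`|g t| `^ r)%:E)%E
  | +oo%E => Lnorm (muI x N) +oo%E (EFin \o g)
  | -oo%E => 0%E
  end.

Definition pdist x N p (g h : R -> R) : \bar R := pnorm x N p (g \- h).

Definition inLp x N p (g : R -> R) : Prop :=
  measurable_fun (Iset x N) g /\ (pnorm x N p g < +oo)%E.

(* the affine maps L_n (n = 1..N) with L_n(x_0) = x_{n-1}, L_n(x_N) = x_n,
   and their inverses *)
Definition La x N n : R := (x n - x n.-1) / (x N - x 0%N).
Definition Lb x N n : R := x n.-1 - La x N n * x 0%N.
Definition Lmap x N n (t : R) : R := La x N n * t + Lb x N n.
Definition Linv x N n (t : R) : R := (t - Lb x N n) / La x N n.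

Definition In (x : nat -> R) (n : nat) : set R :=
  if n == 1%N then [set` `[x 0%N, x 1%N]] else [set` `]x n.-1, x n]].

Definition Top x N (alpha : nat -> R -> R) (f b g : R -> R) : R -> R :=
  fun t => f t + \sum_(1 <= n < N.+1)
     \1_(In x n) t * (alpha n (Linv x N n t) *
                      (g (Linv x N n t) - b (Linv x N n t))).

Definition is_fstar x N alpha p (f b g : R -> R) : Prop :=
  inLp x N p g /\ {ae muI x N, forall t, g t = Top x N alpha f b g t}.

(* f *_T b : the (unique up to a.e. equality) fixed point of T in L^p(I) *)
Definition fstar x N alpha p (f b : R -> R) : R -> R :=
  xget (fun _ => 0) (is_fstar x N alpha p f b).

Definition Lambda x N (alpha : nat -> R -> R) : \bar R :=
  (\big[maxe/0%E]_(1 <= n < N.+1) Lnorm (muI x N) +oo%E (EFin \o alpha n))%E.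

Definition Lambda_p x N alpha (p : \bar R) : R :=
  match p with
  | r%:E => if (1 <= r)%R then fine (Lambda x N alpha)
            else fine (Lambda x N alpha) `^ r
  | _ => fine (Lambda x N alpha)
  end.

Definition starFb x N alpha p (F : set (R -> R)) b :=
  [set fstar x N alpha p f b | f in F].
Definition starfB x N alpha p f (B : set (R -> R)) :=
  [set fstar x N alpha p f b | b in B].
Definition starFB x N alpha p (F B : set (R -> R)) :=
  [set fstar x N alpha p f b | f in F & b in B].

Definition pdelta x N p (g : R -> R) (K : set (R -> R)) : \bar R :=
  ereal_inf [set pdist x N p g h | h in K].
Definition dH x N p (H K : set (R -> R)) : \bar R :=
  maxe (ereal_sup [set pdelta x N p g K | g in H])
       (ereal_sup [set pdelta x N p h H | h in K]).

Definition Lp_open x N p (U : set (R -> R)) : Prop :=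
  forall g, U g -> exists2 e : R, 0 < e &
    forall h, inLp x N p h -> (pdist x N p g h < e%:E)%E -> U h.
Definition Lp_compact x N p (K : set (R -> R)) : Prop :=
  K `<=` inLp x N p /\
  forall (J : Type) (U : J -> set (R -> R)),
    (forall j, Lp_open x N p (U j)) -> K `<=` \bigcup_j U j ->
    exists2 S : set J, finite_set S & K `<=` \bigcup_(j in S) U j.

End FractalDefs.

(* Main.v *)
Require Import Defs.
From HB Require Import structures.
From mathcomp Require Import all_boot all_order all_algebra.
From mathcomp Require Import all_classical all_reals all_analysis.
From mathcomp Require Import measurable_realfun ess_sup_inf.
From mathcomp Require Import ring lra zify.
Import Order.TTheory GRing.Theory Num.Theory.
Import numFieldNormedType.Exports.
Local Open Scope classical_set_scope.
Local Open Scope ring_scope.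
Set Implicit Arguments.
Unset Strict Implicit.
Unset Printing Implicit Defensive.

(* Let sigma be the shift of the partition (sigma = L_n^-1 on I_n) and
   w = alpha_n o sigma on I_n. Then T g = f + Phi (g - b) with
   Phi u = w * (u o sigma). As the slopes of the L_n add up to 1, sigma does not
   increase Lebesgue measure, so Phi contracts the "norm" by the factor L, which
   is Lambda or, for p < 1, Lambda^p. The fixed point is b + u with u the sum of
   the series of the Phi^k (f - b), which converges a.e. by monotone convergence
   applied to its absolute values. Subtracting two fixed point equations gives
     |f * b - f' * b'| <= (|f - f'| + L |b - b'|) / (1 - L),
   and all the Hausdorff estimates are instances of it because f * f = f. *)

(** * Integrals of functions ordered almost everywhere; subadditivity of powers *)

Section ge0_ae_le_integral.
Import HBNNSimple.

(** The integral is the supremum over simple functions below the integrand. One below f, set to 0 on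
    the exceptional null set, keeps its integral and lies below g; so f and g can be arbitrary
    nonnegative functions. *)
Lemma ge0_ae_le_integralT d (T : measurableType d) (R : realType)
    (mu : {measure set T -> \bar R}) (f g : T -> \bar R) :
  (forall t, (0 <= f t)%E) -> (forall t, (0 <= g t)%E) ->
  {ae mu, forall t, (f t <= g t)%E} ->
  (\int[mu]_t f t <= \int[mu]_t g t)%E.
Proof.
move=> f0 g0 [A [mA A0 fgA]].
rewrite [leLHS]ge0_integralTE// [leRHS]ge0_integralTE//.
apply: ge_ereal_sup => _ [h /= hf <-].
have mAc : measurable (~` A) by exact: measurableC.
apply: (@le_trans _ _ (sintegral mu (proj_nnsfun h mAc))); last first.
  apply: ereal_sup_ubound; exists (proj_nnsfun h mAc) => //= t.
  rewrite -[X in (X%:E <= _)%E]/((proj_nnsfun h mAc : T -> R) t) -mrestrict.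
  rewrite patchE; case: ifPn => [|_]; last exact: g0.
  rewrite inE => tA; apply: (le_trans (hf t)).
  by apply: contrapT => fg; apply: tA; apply: fgA.
rewrite -mrestrict -integral_nnsfun//.
have -> : sintegral mu h = (\int[mu]_t (h t)%:E)%E.
  by rewrite integral_nnsfun// patch_setT.
rewrite (@ge0_negligible_integral _ _ _ mu setT A)//.
- by rewrite setTD.
- by apply/measurable_EFinP.
- by move=> t _; rewrite lee_fin.
Qed.

End ge0_ae_le_integral.

(** With s = a + b > 0, the ratios a/s and b/s lie in [0, 1], where y <= y^r; multiplying by s^r and
    adding gives the claim. *)
Lemma powR_subadditive (R : realType) (a b r : R) : 0 <= a -> 0 <= b ->
  0 < r -> r <= 1 -> (a + b) `^ r <= a `^ r + b `^ r.
Proof.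
move=> a0 b0 r0 r1; have [->|an0] := eqVneq a 0.
  by rewrite !add0r lerDr powR_ge0.
have ap : 0 < a by rewrite lt_def an0.
set s := a + b.
have s0 : 0 < s by rewrite ltr_pwDl.
have key (c : R) : 0 <= c -> c <= s -> c / s * s `^ r <= c `^ r.
  move=> c0 cs; have [->|cn0] := eqVneq c 0.
    by rewrite !mul0r powR_ge0.
  have cp : 0 < c by rewrite lt_def cn0.
  have cE : c = c / s * s by rewrite divfK ?gt_eqF.
  rewrite [in leRHS]cE powRM ?divr_ge0 ?(ltW s0)//.
  rewrite ler_wpM2r ?powR_ge0// ger1_powR//.
  by rewrite divr_gt0//= ler_pdivrMr// mul1r.
rewrite (_ : s `^ r = a / s * s `^ r + b / s * s `^ r); last first.
  by rewrite -!mulrDl divff ?mul1r// gt_eqF.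
by apply: lerD; apply: key => //; rewrite /s ?lerDl ?lerDr.
Qed.

(** * The size of a function: L^p norm or integral of the r-th power *)

Section Lp_size.
Context d (T : measurableType d) (R : realType).
Variable mu : {measure set T -> \bar R}.
Implicit Types (p : \bar R) (g h u v : T -> R).

(* [pnorm] of Defs over an arbitrary measure. *)
Definition Lp_size p g : \bar R :=
  match p with
  | r%:E => if (1 <= r)%R then Lnorm mu p (EFin \o g)
            else (\int[mu]_t (`|g t| `^ r)%:E)%E
  | +oo%E => Lnorm mu +oo%E (EFin \o g)
  | -oo%E => 0%E
  end.

(** Outer exponent that merges both finite cases of [Lp_size] into the single formula (int |g|^r)^(e
    r). *)
Let e (r : R) : R := if 1 <= r then r^-1 else 1.

Let e_gt0 r : 0 < r -> 0 < e r.
Proof. by rewrite /e; case: ifPn => //; rewrite invr_gt0. Qed.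

Let Lp_sizeE r g : Lp_size r%:E g =
  ((\int[mu]_t (`|g t| `^ r)%:E) `^ (e r))%E.
Proof.
rewrite /Lp_size /e; case: ifPn => r1; first by rewrite unlock.
rewrite poweRe1//; apply: integral_ge0 => t _.
by rewrite lee_fin powR_ge0.
Qed.

Lemma Lp_size_ge0 p g : (0 <= Lp_size p g)%E.
Proof.
case: p => [r||] //=; last exact: Lnorm_ge0.
case: ifPn => _; first exact: Lnorm_ge0.
by apply: integral_ge0 => t _; rewrite lee_fin powR_ge0.
Qed.

Lemma Lnormy_leP g (c : R) : 0 <= c ->
  (Lnorm mu +oo (EFin \o g) <= c%:E)%E <-> {ae mu, forall t, `|g t| <= c}.
Proof.
(* If the whole space has measure 0, [Lnorm] at +oo is 0 by convention and every property holds
   a.e.; otherwise it is an essential supremum. *)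
move=> c0; rewrite unlock /Lnorm; case: ifPn => mu0; split.
- by move/ess_supP; apply: filterS => t.
- by move=> gc; apply/ess_supP; apply: filterS gc => t.
- move=> _; apply: measure0_ae; apply/eqP; rewrite eq_le measure_ge0 andbT.
  by rewrite leNgt.
- by rewrite lee_fin.
Qed.

Lemma Lp_size_ae_le p g h : (0 < p)%E ->
  {ae mu, forall t, `|g t| <= `|h t|} -> (Lp_size p g <= Lp_size p h)%E.
Proof.
case: p => [r||]// p0 gh.
  rewrite lte_fin in p0.
  rewrite !Lp_sizeE; apply: gt0_ler_poweR.
  - by rewrite ltW// e_gt0.
  - by rewrite in_itv/= leey andbT integral_ge0// => t _;
      rewrite lee_fin powR_ge0.
  - by rewrite in_itv/= leey andbT integral_ge0// => t _;
      rewrite lee_fin powR_ge0.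
  apply: ge0_ae_le_integralT => [t|t|]; rewrite ?lee_fin ?powR_ge0//.
  apply: filterS gh => t gh; rewrite lee_fin ge0_ler_powR ?nnegrE//.
  exact: ltW.
rewrite /Lp_size unlock /Lnorm; case: ifPn => // _.
by apply: le_ess_sup; apply: filterS gh => t; rewrite /= lee_fin.
Qed.

Lemma Lp_size_ae_eq p g h : (0 < p)%E ->
  {ae mu, forall t, g t = h t} -> Lp_size p g = Lp_size p h.
Proof.
move=> p0 gh; apply/eqP; rewrite eq_le !Lp_size_ae_le//;
  by apply: filterS gh => t ->.
Qed.

Lemma Lp_size_norm p g : (0 < p)%E ->
  Lp_size p (fun t => `|g t|) = Lp_size p g.
Proof.
move=> p0; apply/eqP; rewrite eq_le !Lp_size_ae_le//;
  by apply: aeW => t; rewrite normr_id.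
Qed.

Lemma Lp_size0 p : (0 < p)%E -> Lp_size p (fun=> 0) = 0%E.
Proof.
case: p => [r||]// p0; rewrite /Lp_size.
  rewrite lte_fin in p0; case: ifPn => _.
    by rewrite (@Lnorm0 _ _ _ mu r%:E)// eqe gt_eqF.
  under eq_integral do rewrite normr0 powR0 ?gt_eqF//.
  exact: integral0.
by rewrite (@Lnorm0 _ _ _ mu).
Qed.

Lemma Lp_sizeD p g h : (0 < p)%E -> measurable_fun setT g ->
  measurable_fun setT h ->
  (Lp_size p (g \+ h)%R <= Lp_size p g + Lp_size p h)%E.
Proof.
case: p => [r||]// p0 mg mh; last first.
  by apply: (@eminkowski _ _ _ mu g h +oo%E) => //; rewrite leey.
rewrite /Lp_size; case: ifPn => r1; first exact: minkowski_EFin.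
rewrite lte_fin in p0; rewrite -ltNge in r1.
have mr (k : T -> R) : measurable_fun setT k ->
    measurable_fun setT (fun t : T => (`|k t| `^ r)%:E).
  move=> mk; apply/measurable_EFinP.
  apply: (@measurableT_comp _ _ _ _ _ _ (@powR R ^~ r)) => //.
  exact: measurableT_comp.
rewrite -ge0_integralD//; [|exact: mr..].
apply: ge0_ae_le_integralT => [t|t|].
- by rewrite lee_fin powR_ge0.
- by rewrite -EFinD lee_fin addr_ge0// powR_ge0.
apply: aeW => t; rewrite -EFinD lee_fin.
apply: (@le_trans _ _ ((`|g t| + `|h t|) `^ r)).
  by rewrite ge0_ler_powR ?nnegrE ?addr_ge0// ?ler_normD// ltW.
by rewrite powR_subadditive// ltW.
Qed.

(** What a constant factor L >= 0 contributes to the size: for r < 1 the integral of |g|^r is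
    homogeneous of degree r. *)
Definition Lp_rate p (L : R) : R :=
  match p with
  | r%:E => if 1 <= r then L else L `^ r
  | _ => L
  end.

Lemma Lp_rate_ge0 p L : 0 <= L -> 0 <= Lp_rate p L.
Proof. by case: p => //= r L0; case: ifPn => // _; exact: powR_ge0. Qed.

Lemma Lp_rate_lt1 p L : (0 < p)%E -> 0 <= L -> L < 1 -> Lp_rate p L < 1.
Proof.
case: p => //= r; rewrite lte_fin => r0 L0 L1; case: ifPn => // _.
have -> : 1 = 1 `^ r :> R by rewrite powR1.
by rewrite gt0_ltr_powR ?nnegrE.
Qed.

(** Monotone convergence without naming the possibly infinite limit of G: the condition on u says
    |u| <= sup_n G n a.e. For finite p the integrals of (G n)^r stay bounded, so the limit of these
    powers has finite integral and is finite a.e.; its power 1/r bounds G. For p = +oo a countable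
    union of null sets suffices. *)
Lemma Lp_size_monotone p (G : nat -> T -> R) (C : R) : (0 < p)%E ->
  (forall n, measurable_fun setT (G n)) -> (forall n t, 0 <= G n t) ->
  (forall t, nondecreasing_seq (G ^~ t)) ->
  (forall n, (Lp_size p (G n) <= C%:E)%E) ->
  {ae mu, forall t, exists M, forall n, G n t <= M} /\
  forall u, {ae mu, forall t M, (forall n, G n t <= M) -> `|u t| <= M} ->
    (Lp_size p u <= C%:E)%E.
Proof.
case: p => [r||]// p0 mG G0 ndG GC; last first.
  have C0 : 0 <= C.
    by rewrite -lee_fin; apply: le_trans (GC 0%N); exact: Lp_size_ge0.
  have bnd : {ae mu, forall t, forall n, G n t <= C}.
    apply/ae_foralln => n; have /(Lnormy_leP (G n) C0) := GC n.
    by apply: filterS => t; rewrite ger0_norm.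
  split; first by apply: filterS bnd => t h; exists C.
  move=> u hu; apply/(Lnormy_leP u C0).
  by move: bnd hu; apply: filterS2 => t h; apply.
rewrite lte_fin in p0.
pose H n t : \bar R := (G n t `^ r)%:E.
have mH n : measurable_fun setT (H n).
  apply/measurable_EFinP.
  exact: (@measurableT_comp _ _ _ _ _ _ (@powR R ^~ r)).
have H0 n t : (0 <= H n t)%E by rewrite lee_fin powR_ge0.
have ndH t : nondecreasing_seq (H ^~ t).
  move=> m n mn; rewrite lee_fin ge0_ler_powR ?nnegrE//; first exact: ltW.
  exact: ndG.
pose Hoo t := limn (H ^~ t).
have Hoo0 t : (0 <= Hoo t)%E.
  apply: lime_ge; first exact: ereal_nondecreasing_is_cvgn.
  by apply: nearW.
have HHoo n t : (H n t <= Hoo t)%E.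
  apply: lime_ge; first exact: ereal_nondecreasing_is_cvgn.
  by exists n => // m /= nm; exact: ndH.
have C0 : 0 <= C.
  by rewrite -lee_fin; apply: le_trans (GC 0%N); exact: Lp_size_ge0.
(* The outer exponent is undone by raising to the power 1 / e r. *)
have intH n : (\int[mu]_t H n t <= (C `^ (e r)^-1)%:E)%E.
  have := GC n; rewrite Lp_sizeE => GCn.
  have -> : (\int[mu]_t H n t = \int[mu]_t (`|G n t| `^ r)%:E)%E.
    by apply: eq_integral => t _; rewrite ger0_norm.
  set X := (\int[mu]_t _)%E in GCn *.
  have X0 : (0 <= X)%E by apply: integral_ge0 => t _; rewrite lee_fin powR_ge0.
  have -> : X = ((X `^ e r) `^ (e r)^-1)%E.
    by rewrite -poweRrM divff ?poweRe1// gt_eqF// e_gt0.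
  rewrite -poweR_EFin; apply: gt0_ler_poweR => //.
  - by rewrite invr_ge0 ltW// e_gt0.
  - by rewrite in_itv/= leey andbT poweR_ge0.
  - by rewrite in_itv/= leey andbT lee_fin.
have intHoo : (\int[mu]_t Hoo t <= (C `^ (e r)^-1)%:E)%E.
  rewrite monotone_convergence//.
  apply: lime_le; last exact: nearW.
  apply: ereal_nondecreasing_is_cvgn => m n mn.
  by apply: ge0_le_integral => // t _; exact: ndH.
have mHoo : measurable_fun setT Hoo.
  apply: (@emeasurable_fun_cvg _ _ _ setT H Hoo) => // t _.
  exact: ereal_nondecreasing_is_cvgn.
have Hoo_fin : {ae mu, forall t, Hoo t \is a fin_num}.
  have : mu.-integrable setT Hoo.
    apply/integrableP; split => //.
    under eq_integral do rewrite gee0_abs//.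
    by apply: le_lt_trans intHoo _; rewrite ltry.
  by move/(integrable_ae measurableT); apply: filterS => t; exact.
have GM t n : Hoo t \is a fin_num -> G n t <= fine (Hoo t) `^ r^-1.
  move=> Hfin.
  have -> : G n t = (G n t `^ r) `^ r^-1.
    by rewrite -powRrM divff ?gt_eqF// powRr1.
  rewrite ge0_ler_powR ?nnegrE ?invr_ge0 ?powR_ge0 ?fine_ge0//.
    exact: ltW.
  by rewrite -lee_fin fineK//; exact: HHoo.
split.
  apply: filterS Hoo_fin => t Hfin.
  by exists (fine (Hoo t) `^ r^-1) => n; exact: GM.
move=> u hu; rewrite Lp_sizeE.
have -> : C%:E = ((C `^ (e r)^-1)%:E `^ e r)%E.
  by rewrite poweR_EFin -powRrM mulVf ?powRr1// gt_eqF// e_gt0.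
have u0 : (0 <= \int[mu]_t (`|u t| `^ r)%:E)%E.
  by apply: integral_ge0 => t _; rewrite lee_fin powR_ge0.
apply: gt0_ler_poweR.
- by rewrite ltW// e_gt0.
- by rewrite in_itv/= leey andbT.
- by rewrite in_itv/= leey andbT lee_fin powR_ge0.
apply: le_trans intHoo; apply: ge0_ae_le_integralT => //.
move: hu Hoo_fin; apply: filterS2 => t hu Hfin.
rewrite -[leRHS]fineK// lee_fin.
have -> : fine (Hoo t) = (fine (Hoo t) `^ r^-1) `^ r.
  by rewrite -powRrM mulVf ?powRr1 ?fine_ge0// gt_eqF.
rewrite ge0_ler_powR ?nnegrE ?powR_ge0//; first exact: ltW.
by apply: hu => n; exact: GM.
Qed.

(** * Weighted composition operators and their fixed points *)

Section weighted_composition.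
Variables (sigma : T -> T) (w : T -> R) (rho : R).
Hypothesis msigma : measurable_fun setT sigma.
Hypothesis sigma_le : forall A, measurable A ->
  (mu (sigma @^-1` A) <= mu A)%E.
Hypothesis mw : measurable_fun setT w.
Hypothesis rho0 : 0 <= rho.
Hypothesis w_le : {ae mu, forall t, `|w t| <= rho}.

(** By [sigma_le] the preimage of a null set is null. *)
Lemma ae_nonsingular (P : T -> Prop) :
  {ae mu, forall t, P t} -> {ae mu, forall t, P (sigma t)}.
Proof.
move=> [A [mA A0 PA]]; exists (sigma @^-1` A); split.
- by rewrite -[_ @^-1` _]setTI; exact: msigma.
- by apply/eqP; rewrite eq_le measure_ge0 andbT -A0 sigma_le.
- by move=> t /= Pt; exact: PA.
Qed.

(** The operator Phi of the overview. *)
Definition wcomp g : T -> R := fun t => w t * g (sigma t).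

Lemma measurable_wcomp g : measurable_fun setT g ->
  measurable_fun setT (wcomp g).
Proof. by move=> mg; apply: measurable_funM => //; exact: measurableT_comp. Qed.

(** The weight contributes rho. Composition with sigma does not increase the integral: |g o sigma|^r
    integrates to the integral of |g|^r against the pushforward of mu, which is at most mu by
    [sigma_le]. For p = +oo the a.e. bound on g is transported along sigma. *)
Lemma Lp_size_wcomp p g : (0 < p)%E -> measurable_fun setT g ->
  (Lp_size p g < +oo)%E ->
  (Lp_size p (wcomp g) <= (Lp_rate p rho)%:E * Lp_size p g)%E.
Proof.
case: p => [r||]// p0 mg goo.
  rewrite lte_fin in p0.
  have Jge0 (k : T -> R) : (0 <= \int[mu]_t (`|k t| `^ r)%:E)%E.
    by apply: integral_ge0 => t _; rewrite lee_fin powR_ge0.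
  have -> : Lp_rate r%:E rho = rho `^ (r * e r).
    rewrite /Lp_rate /e; case: ifPn => _; last by rewrite mulr1.
    by rewrite divff ?gt_eqF// powRr1.
  rewrite !Lp_sizeE powRrM -poweR_EFin -poweRM ?lee_fin ?powR_ge0//.
  apply: gt0_ler_poweR.
  - by rewrite ltW// e_gt0.
  - by rewrite in_itv/= leey andbT.
  - by rewrite in_itv/= leey andbT mule_ge0// lee_fin powR_ge0.
  have mk : measurable_fun setT (fun t : T => (`|g t| `^ r)%:E).
    apply/measurable_EFinP.
    apply: (@measurableT_comp _ _ _ _ _ _ (@powR R ^~ r)) => //.
    exact: measurableT_comp.
  apply: (@le_trans _ _
    (\int[mu]_t ((rho `^ r)%:E * (`|g (sigma t)| `^ r)%:E))%E).
    apply: ge0_ae_le_integralT => [t|t|].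
    - by rewrite lee_fin powR_ge0.
    - by rewrite mule_ge0// lee_fin powR_ge0.
    apply: filterS w_le => t wt; rewrite -EFinM lee_fin -powRM//.
    rewrite ge0_ler_powR ?nnegrE ?mulr_ge0//; first exact: ltW.
    by rewrite /wcomp normrM ler_wpM2r.
  rewrite ge0_integralZl//; last 2 first.
  - exact: (measurableT_comp mk msigma).
  - by rewrite lee_fin powR_ge0.
  apply: lee_pmul => //; first by rewrite lee_fin powR_ge0.
  have := @ge0_integral_pushforward _ _ _ _ R sigma msigma mu setT
    (fun t => (`|g t| `^ r)%:E) measurableT mk.
  rewrite preimage_setT => <-; last by move=> t _; rewrite lee_fin powR_ge0.
  exact: ge0_le_measure_integral.
have c0 : 0 <= fine (Lnorm mu +oo (EFin \o g)) by rewrite fine_ge0// Lnorm_ge0.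
have cE : Lnorm mu +oo (EFin \o g) = (fine (Lnorm mu +oo (EFin \o g)))%:E.
  by rewrite fineK// ge0_fin_numE// Lnorm_ge0.
rewrite /Lp_size /Lp_rate cE -EFinM.
apply/Lnormy_leP; first by rewrite mulr_ge0.
have /ae_nonsingular : {ae mu, forall t,
    `|g t| <= fine (Lnorm mu +oo (EFin \o g))}.
  by apply/(Lnormy_leP g c0); rewrite -cE.
move: w_le; apply: filterS2 => t wt gt.
by rewrite /wcomp normrM ler_pM.
Qed.

Lemma wcomp_fixpoint p v : (0 < p)%E -> rho < 1 ->
  measurable_fun setT v -> (Lp_size p v < +oo)%E ->
  exists u, [/\ measurable_fun setT u, (Lp_size p u < +oo)%E &
    {ae mu, forall t, u t = v t + wcomp u t}].
Proof.
move=> p0 rho1 mv voo.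
set L := Lp_rate p rho; have L0 : 0 <= L := Lp_rate_ge0 p rho0.
have L1 : L < 1 := Lp_rate_lt1 p0 rho0 rho1.
pose c := fine (Lp_size p v).
have cE : Lp_size p v = c%:E by rewrite fineK// ge0_fin_numE// Lp_size_ge0.
have c0 : 0 <= c by rewrite fine_ge0// Lp_size_ge0.
pose V k := iter k wcomp v.
have mV k : measurable_fun setT (V k).
  by elim: k => //= k IH; exact: measurable_wcomp.
have VL k : (Lp_size p (V k) <= (L ^+ k * c)%:E)%E.
  elim: k => [|k IH]; first by rewrite expr0 mul1r cE.
  apply: (le_trans (Lp_size_wcomp p0 (mV k) _)).
    by apply: le_lt_trans IH _; rewrite ltry.
  by rewrite exprS -mulrA EFinM lee_wpmul2l.
(* Partial sums of absolute values: they increase and have size at most c / (1 - L), as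
   [Lp_size_monotone] requires. *)
pose S n t : R := \sum_(0 <= k < n) `|V k t|.
have mS n : measurable_fun setT (S n).
  by apply: measurable_sum => k; exact: measurableT_comp.
have SS n t : S n.+1 t = S n t + `|V n t| by rewrite /S big_nat_recr.
have SC n : (Lp_size p (S n) <= ((1 - L ^+ n) / (1 - L) * c)%:E)%E.
  elim: n => [|n IH].
    rewrite expr0 subrr !mul0r (_ : S 0%N = fun=> 0) ?Lp_size0//.
    by apply/funext => t; rewrite /S big_geq.
  rewrite (_ : S n.+1 = S n \+ (fun t => `|V n t|)); last first.
    by apply/funext => t; rewrite SS.
  apply: (le_trans (Lp_sizeD p0 (mS n) _)); first exact: measurableT_comp.
  rewrite Lp_size_norm//; apply: le_trans (leeD IH (VL n)) _.
  rewrite -EFinD lee_fin le_eqVlt; apply/orP; left; apply/eqP.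
  have L1' : 1 - L != 0 by rewrite subr_eq0 gt_eqF.
  by rewrite exprS; field.
have SCoo n : (Lp_size p (S n) <= (c / (1 - L))%:E)%E.
  apply: (le_trans (SC n)); rewrite lee_fin mulrAC.
  rewrite ler_wpM2r ?invr_ge0 ?subr_ge0 ?(ltW L1)//.
    by rewrite ler_piMl// gerBl exprn_ge0.
have ndS t : nondecreasing_seq (S ^~ t).
  by apply/nondecreasing_seqP => n; rewrite SS lerDl.
have S0 n t : 0 <= S n t by apply: sumr_ge0.
have [Sbnd Sle] := Lp_size_monotone p0 mS S0 ndS SCoo.
pose s n t : R := \sum_(0 <= k < n) V k t.
have ms n : measurable_fun setT (s n) by apply: measurable_sum => k.
(* A limsup is defined and measurable everywhere; where the series converges it is its sum. *)
pose u t := fine (limn_esup (fun n => (s n t)%:E)).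
have mu_ : measurable_fun setT u.
  apply: (measurableT_comp (fine_measurable _)) => //.
  by apply: measurable_fun_limn_esup => n; exact/measurable_EFinP.
have ucvg : {ae mu, forall t, s ^~ t @ \oo --> u t}.
  apply: filterS Sbnd => t [M SM].
  have cs : cvgn (s ^~ t).
    have : cvgn (S ^~ t).
      apply: nondecreasing_is_cvgn; first exact: ndS.
      by exists M => _ [n _ <-]; exact: SM.
    exact: (@normed_cvg _ _ (V ^~ t)).
  have cse : (fun n => (s n t)%:E) @ \oo --> (limn (s ^~ t))%:E.
    by apply: cvg_EFin => //; exact: nearW.
  rewrite /u is_cvg_limn_esupE; last exact: cvgP cse.
  by rewrite (cvg_lim _ cse).
exists u; split => //.
(* Any bound M of the sums of absolute values bounds every |s n t|, hence also the limit |u t|. *)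
- apply: (@le_lt_trans _ _ (c / (1 - L))%:E); last by rewrite ltry.
  apply: Sle; apply: filterS ucvg => t cu M SM.
  apply: (@le_trans _ _ (limn (fun n => `|s n t|))).
    by rewrite (cvg_lim _ (cvg_norm cu)).
  apply: limr_le; first exact: cvgP (cvg_norm cu).
  by apply: nearW => n; apply: le_trans (SM n); exact: ler_norm_sum.
(* The partial sums converge at t and, by nonsingularity, at sigma t; the limit of s (n+1) = v + w
   (s n o sigma) is the fixed point equation. *)
- have := ae_nonsingular ucvg; move: ucvg; apply: filterS2 => t cu cus.
  have s_rec n : s n.+1 t = v t + w t * s n (sigma t).
    rewrite /s big_nat_recl//= mulr_sumr; congr (_ + _).
  have h1 : (fun n => s n.+1 t) @ \oo --> u t by rewrite (cvg_shiftS (s ^~ t)).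
  have h2 : (fun n => s n.+1 t) @ \oo --> v t + wcomp u t.
    rewrite (eq_cvg _ _ s_rec); apply: cvgD; first exact: cvg_cst.
    by apply: cvgM => //; exact: cvg_cst.
  exact: (cvg_unique _ h1 h2).
Qed.

End weighted_composition.
End Lp_size.

(** The pushforward of Lebesgue measure under t -> (t - c) / a, divided by a, has the right value on
    half-open intervals; uniqueness of Lebesgue measure extends this to all measurable sets. *)
Lemma lebesgue_measure_preimage_affine (R : realType) (a c : R)
    (A : set (measurableTypeR R)) : 0 < a -> measurable A ->
  lebesgue_measure [set t : measurableTypeR R | A ((t - c) / a)] =
  (a%:E * lebesgue_measure A)%E.
Proof.
move=> a0 mA.
pose phi (t : measurableTypeR R) : measurableTypeR R := (t - c) / a.
have mphi : measurable_fun setT phi.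
  by apply: measurable_funM => //; exact: measurable_funB.
have ai0 : 0 <= a^-1 by rewrite invr_ge0 ltW.
pose nu_ := mscale (NngNum ai0) (pushforward (@lebesgue_measure R) phi).
pose nu := nu_ mphi.
have nuE B : nu B = (a^-1%:E * lebesgue_measure (phi @^-1` B))%E by [].
have -> : [set t | A ((t - c) / a)] = phi @^-1` A by [].
suff -> : lebesgue_measure A = nu A.
  by rewrite nuE muleA -EFinM divff ?mul1e ?gt_eqF.
apply: lebesgue_measure_unique => // X [[u v] _ <-].
rewrite /= -[RHS]/(nu `]u, v]%classic) nuE.
have -> : phi @^-1` `]u, v]%classic = `]a * u + c, a * v + c]%classic.
  apply/seteqP; split => t; rewrite /= !in_itv/= /phi.
    by rewrite ltr_pdivlMr// ler_pdivrMr// ltrBrDr lerBlDr !(mulrC a).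
  by rewrite ltr_pdivlMr// ler_pdivrMr// ltrBrDr lerBlDr !(mulrC a).
rewrite !lebesgue_measure_itv/= !lte_fin ltrD2r ltr_pM2l//.
case: ifPn => _; last by rewrite mule0.
rewrite -!EFinD -EFinM; congr EFin; field.
by rewrite gt_eqF.
Qed.

(** * The partition, its pieces and its shift *)

Section partition.
Context (R : realType) (N : nat) (x : nat -> R).
Hypothesis N2 : (2 <= N)%N.
Hypothesis xlt : forall i, (i < N)%N -> x i < x i.+1.

Let xle i j : (i <= j)%N -> (j <= N)%N -> x i <= x j.
Proof.
elim: j => [|j IH]; first by rewrite leqn0 => /eqP ->.
rewrite leq_eqVlt => /predU1P[->//|]; rewrite ltnS => ij jN.
by rewrite (le_trans (IH ij (ltnW jN)))// ltW// xlt.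
Qed.

Let x0N : x 0%N < x N.
Proof.
rewrite (lt_le_trans (xlt _))//; first by lia.
by apply: xle => //; lia.
Qed.

Lemma In_bounds n t : (1 <= n <= N)%N -> In x n t -> x n.-1 <= t <= x n.
Proof.
move=> n1; rewrite /In; case: eqP => [->|_] /=; rewrite in_itv/=; first by [].
by case/andP => /ltW -> ->.
Qed.

Lemma In_gt n t : (1 < n)%N -> In x n t -> x n.-1 < t.
Proof.
move=> n1; rewrite /In; case: eqP => [E|_] /=; first by lia.
by rewrite in_itv/= => /andP[].
Qed.

(** For m < n the piece m ends at x m <= x (n-1), and the piece n is open on the left since n >
    1. *)
Lemma In_inj m n t : (1 <= m <= N)%N -> (1 <= n <= N)%N ->
  In x m t -> In x n t -> m = n.
Proof.
wlog mn : m n / (m < n)%N.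
  move=> H m1 n1 tm tn; case: (ltngtP m n) => // mn; first exact: H.
  by apply/esym; exact: H.
move=> m1 n1 /(In_bounds m1)/andP[_ tm] /In_gt tn.
have /(le_trans tm) : x m <= x n.-1 by apply: xle; lia.
by rewrite leNgt tn//; lia.
Qed.

Lemma Iset_cover t : Iset x N t -> exists2 n, (1 <= n <= N)%N & In x n t.
Proof.
rewrite /Iset/= in_itv/= => /andP[t0 tN].
have [tx1|tx1] := leP t (x 1%N).
  by exists 1%N; [lia|rewrite /In eqxx/= in_itv/= t0].
(* Past the first piece, the index is the least n with t <= x n; minimality gives x (n-1) < t. *)
have ex : exists n, t <= x n by exists N.
case: (ex_minnP ex) => n tn nmin.
have n1 : (1 < n)%N.
  rewrite ltnNge; apply/negP => n1.
  have : x n <= x 1%N by apply: xle => //; lia.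
  by rewrite leNgt => /negP; apply; exact: lt_le_trans tn.
exists n; first by rewrite (ltnW n1) nmin.
rewrite /In gtn_eqF//= in_itv/= tn andbT ltNge; apply/negP => /nmin; lia.
Qed.

(** The pieces are disjoint, so one indicator survives. This evaluates the functions defined
    piecewise: [Top], [shift] and [weight]. *)
Lemma sum_In n t (c : nat -> R) : (1 <= n <= N)%N -> In x n t ->
  \sum_(1 <= m < N.+1) \1_(In x m) t * c m = c n.
Proof.
move=> n1 tn; rewrite (bigD1_seq n) ?mem_index_iota ?iota_uniq//=.
rewrite indicE mem_set// mul1r big1_seq ?addr0// => m.
rewrite mem_index_iota => /andP[mn m1]; rewrite indicE memNset ?mul0r// => tm.
by move/eqP: mn; apply; apply: (In_inj _ _ tm tn).
Qed.

Lemma La_gt0 n : (1 <= n <= N)%N -> 0 < La x N n.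
Proof.
move=> n1; rewrite /La divr_gt0 ?subr_gt0//.
by have := @xlt n.-1; rewrite prednK; [apply|]; lia.
Qed.

Lemma sum_La : \sum_(1 <= n < N.+1) La x N n = 1.
Proof.
rewrite big_add1/= -mulr_suml telescope_sumr//.
by rewrite divff// subr_eq0 gt_eqF.
Qed.

Lemma Linv_Iset n t : (1 <= n <= N)%N -> In x n t -> Iset x N (Linv x N n t).
Proof.
move=> n1 /(In_bounds n1)/andP[tl tr].
have a0 := La_gt0 n1; rewrite /Iset/= in_itv/= /Linv.
rewrite ler_pdivlMr// ler_pdivrMr// /Lb.
have h : x N * La x N n = x n - x n.-1 + La x N n * x 0%N.
  rewrite /La; field; by rewrite subr_eq0 gt_eqF.
rewrite h; apply/andP; split; lra.
Qed.

Lemma measurable_In n : measurable (In x n).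
Proof. by rewrite /In; case: ifP => _; exact: measurable_itv. Qed.

Lemma measurable_Iset : measurable (Iset x N).
Proof. exact: measurable_itv. Qed.

Lemma measurable_Linv n : measurable_fun setT (Linv x N n).
Proof. by apply: measurable_funM => //; exact: measurable_funB. Qed.

Lemma lebesgue_measure_Linv n A : (1 <= n <= N)%N -> measurable A ->
  lebesgue_measure (Linv x N n @^-1` A) =
  ((La x N n)%:E * lebesgue_measure A)%E.
Proof.
move=> n1 mA; apply: lebesgue_measure_preimage_affine => //; exact: La_gt0.
Qed.

Lemma ae_muI2 (P Q S : R -> Prop) : (forall t, P t -> Q t -> S t) ->
  {ae muI x N, forall t, P t} -> {ae muI x N, forall t, Q t} ->
  {ae muI x N, forall t, S t}.
Proof. exact: (@filterS2 _ _ (ae_filter_ringOfSetsType (muI x N))). Qed.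

(* The filter instance of almost_everywhere is not inferred through the
   definition of [muI], hence these two specializations. *)
Lemma ae_muI1 (P Q : R -> Prop) : (forall t, P t -> Q t) ->
  {ae muI x N, forall t, P t} -> {ae muI x N, forall t, Q t}.
Proof. exact: (@filterS _ _ (ae_filter_ringOfSetsType (muI x N))). Qed.

(** [muI] is a measure on the whole line that vanishes off the interval, so results on the full
    space apply and outside points can be ignored. *)
Lemma ae_Iset : {ae muI x N, forall t, Iset x N t}.
Proof.
exists (~` Iset x N); split => //.
- by apply: measurableC; exact: measurable_Iset.
- by rewrite /muI /mrestr -/(Iset x N) setICl measure0.
Qed.

(** The sigma of the overview. Gluing the branches by indicators reduces measurability to sums and
    products; off the interval the value is 0. *)
Definition shift (t : R) : R :=
  \sum_(1 <= n < N.+1) \1_(In x n) t * Linv x N n t.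

Lemma measurable_shift : measurable_fun setT shift.
Proof.
apply: measurable_sum => n; apply: measurable_funM; last exact: measurable_Linv.
by apply: measurable_indic; exact: measurable_In.
Qed.

Lemma shift_In n t : (1 <= n <= N)%N -> In x n t -> shift t = Linv x N n t.
Proof. exact: sum_In. Qed.

Lemma shift_Iset t : Iset x N t -> Iset x N (shift t).
Proof.
by move=> /Iset_cover[n n1 tn]; rewrite (shift_In n1 tn); exact: Linv_Iset.
Qed.

(** Let A' be A cut to the interval. Inside the interval the preimage of A lies in the union of the
    preimages of A' under the maps [Linv], whose measures are the slopes times that of A'; the
    slopes sum to 1. *)
Lemma muI_shift_le A : measurable A -> (muI x N (shift @^-1` A) <= muI x N A)%E.
Proof.
move=> mA; rewrite /muI /mrestr -/(Iset x N).
have mAI : measurable (A `&` Iset x N).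
  by apply: measurableI => //; exact: measurable_Iset.
(* Indices start at 0 here: [E n] belongs to the piece n + 1. *)
pose E n := Linv x N n.+1 @^-1` (A `&` Iset x N).
have mE n : measurable (E n).
  by rewrite -[E n]setTI; apply: measurable_Linv.
apply: (@le_trans _ _ (lebesgue_measure (\big[setU/set0]_(i < N) E i))).
  apply: le_measure; rewrite ?inE.
  - apply: measurableI; last exact: measurable_Iset.
    by rewrite -[_ @^-1` _]setTI; apply: measurable_shift.
  - by apply: bigsetU_measurable => i _; exact: mE.
  move=> t [/= tA tI]; rewrite -bigcup_mkord.
  have [n n1 tn] := Iset_cover tI.
  exists n.-1 => /=; first lia.
  rewrite /E/= prednK; last lia.
  by rewrite -(shift_In n1 tn); split => //; exact: shift_Iset.
apply: le_trans; first by apply: Boole_inequality => i _; exact: mE.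
apply: (@le_trans _ _ (\sum_(i < N)
    (La x N i.+1)%:E * lebesgue_measure (A `&` Iset x N))%E).
  by apply: lee_sum => i _; rewrite -lebesgue_measure_Linv//; exact: ltn_ord.
rewrite -ge0_sume_distrl; last first.
  by move=> i _; rewrite lee_fin; apply/ltW/La_gt0; rewrite /= ltn_ord.
by have := sum_La; rewrite big_add1/= big_mkord sumEFin => ->; rewrite mul1e.
Qed.


(** * The operator T, its fixed points and their dependence on the data *)

Variables (alpha : nat -> R -> R) (p : \bar R).
Hypothesis malpha : forall n, (1 <= n <= N)%N ->
  measurable_fun (Iset x N) (alpha n).
Hypothesis Lambda_lt1 : (Lambda x N alpha < 1)%E.
Hypothesis p0 : (0 < p)%E.
Implicit Types f b g h : R -> R.

Let I := Iset x N.
Let mI : measurable I := measurable_Iset.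

(** The w of the overview. Each [alpha n] is extended by 0, as its measurability is given on the
    interval only. *)
Definition weight (t : R) : R :=
  \sum_(1 <= n < N.+1) \1_(In x n) t * (alpha n \_ (Iset x N)) (Linv x N n t).

Lemma measurable_weight : measurable_fun setT weight.
Proof.
rewrite /weight; under eq_fun do rewrite big_add1/= big_mkord.
apply: measurable_sum => i; apply: measurable_funM.
  by apply: measurable_indic; exact: measurable_In.
have mai : measurable_fun setT (alpha i.+1 \_ I).
  by apply/(measurable_restrictT _ mI); apply: malpha; rewrite /= ltn_ord.
exact: (measurableT_comp mai (measurable_Linv _)).
Qed.

Lemma Lambda_ge0 : (0 <= Lambda x N alpha)%E.
Proof. by rewrite /Lambda; elim/big_ind: _ => // [a b a0 _|n _];
  [rewrite le_max a0|exact: Lnorm_ge0]. Qed.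

Let L := Lambda_p x N alpha p.

Let rho := fine (Lambda x N alpha).

Let LambdaE : Lambda x N alpha = rho%:E.
Proof.
by rewrite fineK// ge0_fin_numE ?Lambda_ge0// (lt_le_trans Lambda_lt1)// leey.
Qed.

Let rho0 : 0 <= rho. Proof. by rewrite fine_ge0// Lambda_ge0. Qed.

Let rho1 : rho < 1. Proof. by rewrite -lte_fin -LambdaE. Qed.

Lemma ae_weight_le : {ae muI x N, forall t, `|weight t| <= rho}.
Proof.
(* The range of n is put inside the a.e. statement, so that the bounds for all n can be merged into
   one and transported along [shift]. *)
have an n : {ae muI x N, forall t, (1 <= n <= N)%N -> `|alpha n t| <= rho}.
  have [n1|n1] := boolP (1 <= n <= N)%N; last by apply: aeW.
  have : (Lnorm (muI x N) +oo (EFin \o alpha n) <= rho%:E)%E.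
    rewrite -LambdaE /Lambda (bigD1_seq n) ?mem_index_iota ?iota_uniq//=.
    by rewrite le_max lexx.
  by move/(Lnormy_leP _ _ rho0); apply: ae_muI1.
have := ae_nonsingular (mu := muI x N) measurable_shift muI_shift_le
  (ae_foralln an).
move: ae_Iset; apply: ae_muI2 => t tI at_.
have [n n1 tn] := Iset_cover tI.
rewrite /weight (sum_In (fun m => (alpha m \_ I) (Linv x N m t)) n1 tn).
rewrite patchE mem_set; last exact: Linv_Iset.
by rewrite -(shift_In n1 tn); exact: at_.
Qed.

(** This is T g = f + Phi (g - b). Cutting g - b to the interval is harmless because [shift] maps
    the interval into itself. *)
Lemma TopE f b g t : I t ->
  Top x N alpha f b g t = f t + wcomp shift weight ((g \- b)%R \_ I) t.
Proof.
move=> tI; have [n n1 tn] := Iset_cover tI.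
rewrite /Top /wcomp (sum_In (fun m => alpha m (Linv x N m t) *
  (g (Linv x N m t) - b (Linv x N m t))) n1 tn).
rewrite /weight (sum_In (fun m => (alpha m \_ I) (Linv x N m t)) n1 tn).
by rewrite (shift_In n1 tn) !patchE mem_set//; exact: Linv_Iset.
Qed.

(** Extension by 0 turns measurability on the interval into measurability on the line, the setting
    of the results on [Lp_size]. *)
Lemma pnormE g : pnorm x N p g = Lp_size (muI x N) p (g \_ I).
Proof.
transitivity (Lp_size (muI x N) p g); first by case: (p).
apply: Lp_size_ae_eq => //; move: ae_Iset; apply: ae_muI1 => t tI.
by rewrite patchE mem_set.
Qed.

Lemma pnorm_ge0 g : (0 <= pnorm x N p g)%E.
Proof. by rewrite pnormE Lp_size_ge0. Qed.

Lemma pnorm_fin_num g : inLp x N p g -> pnorm x N p g \is a fin_num.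
Proof. by case=> _; rewrite ge0_fin_numE// pnorm_ge0. Qed.

Lemma pdist_sym g h : pdist x N p g h = pdist x N p h g.
Proof.
rewrite /pdist !pnormE -Lp_size_norm// -[RHS]Lp_size_norm//; congr Lp_size.
by apply/funext => t; rewrite !patchE; case: ifPn => // _; exact: distrC.
Qed.

Lemma pnormD g h : measurable_fun I g -> measurable_fun I h ->
  (pnorm x N p (g \+ h)%R <= pnorm x N p g + pnorm x N p h)%E.
Proof.
move=> mg mh; rewrite !pnormE.
rewrite (_ : _ \_ I = (g \_ I) \+ (h \_ I)); last first.
  by apply/funext => t; rewrite /= !patchE; case: ifPn => // _; rewrite addr0.
by apply: Lp_sizeD => //; exact/(measurable_restrictT _ mI).
Qed.

Lemma pdist_le g h : measurable_fun I g -> measurable_fun I h ->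
  (pdist x N p g h <= pnorm x N p g + pnorm x N p h)%E.
Proof.
move=> mg mh; have -> : pnorm x N p h = pnorm x N p (\- h).
  have := pdist_sym h (fun=> 0); rewrite /pdist.
  have -> : h \- (fun=> 0) = h by apply/funext => t /=; rewrite subr0.
  by move=> ->; congr pnorm; apply/funext => t /=; rewrite sub0r.
by apply: pnormD => //; exact: measurableT_comp.
Qed.

Lemma inLpB g h : inLp x N p g -> inLp x N p h -> inLp x N p (g \- h)%R.
Proof.
move=> [mg goo] [mh hoo]; split; first exact: measurable_funB.
by apply: le_lt_trans (pdist_le mg mh) _; exact: lte_add_pinfty.
Qed.

(** [xget] returns a fixed point as soon as one exists. *)
Lemma fstarP f b : inLp x N p f -> inLp x N p b ->
  is_fstar x N alpha p f b (fstar x N alpha p f b).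
Proof.
move=> fL bL; apply: xgetPex.
have [mfb fboo] := inLpB fL bL.
have mv : measurable_fun setT ((f \- b)%R \_ I).
  exact/(measurable_restrictT _ mI).
have voo : (Lp_size (muI x N) p ((f \- b)%R \_ I) < +oo)%E by rewrite -pnormE.
have [u [mu_ uoo uE]] := wcomp_fixpoint (mu := muI x N) measurable_shift
  muI_shift_le measurable_weight rho0 ae_weight_le p0 rho1 mv voo.
have muI_ : measurable_fun I u by exact: measurable_funS mu_.
have uL : (pnorm x N p u < +oo)%E.
  rewrite pnormE (@Lp_size_ae_eq _ _ _ _ p _ u)//.
  by move: ae_Iset; apply: ae_muI1 => t tI; rewrite patchE mem_set.
(* As u = (f - b) + Phi u, adding b gives u + b = f + Phi ((u + b) - b). *)
exists (u \+ b); split.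
  split; first by apply: measurable_funD => //; case: bL.
  apply: le_lt_trans (pnormD muI_ bL.1) _.
  by apply: lte_add_pinfty => //; case: bL.
move: ae_Iset uE; apply: ae_muI2 => t tI uE.
rewrite TopE//= {1}uE /wcomp !patchE !mem_set//; last exact: shift_Iset.
by rewrite /= addrK addrAC subrK.
Qed.

Let LE : L = Lp_rate p rho. Proof. by rewrite /L /rho; case: (p). Qed.

Lemma Lambda_p_ge0 : 0 <= L. Proof. by rewrite LE Lp_rate_ge0. Qed.

Lemma Lambda_p_lt1 : L < 1. Proof. by rewrite LE Lp_rate_lt1. Qed.

(* g - g' = (f - f') + Phi ((g - g') - (b - b')) with Phi an L-contraction;
   the triangle inequality is then solved for the distance of g and g'. *)
Lemma fstar_lipschitz (f f' b b' g g' : R -> R) :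
  inLp x N p f -> inLp x N p f' -> inLp x N p b -> inLp x N p b' ->
  is_fstar x N alpha p f b g -> is_fstar x N alpha p f' b' g' ->
  (pdist x N p g g' <=
    (1 / (1 - L))%:E * (pdist x N p f f' + L%:E * pdist x N p b b'))%E.
Proof.
move=> fL fL' bL bL' [gL gE] [gL' gE'].
have L0 := Lambda_p_ge0; have L1 := Lambda_p_lt1.
have ggL := inLpB gL gL'; have ffL := inLpB fL fL'; have bbL := inLpB bL bL'.
pose h : R -> R := ((g \- g') \- (b \- b'))%R.
have hL : inLp x N p h by exact: inLpB.
have mh : measurable_fun setT (h \_ I).
  by apply/(measurable_restrictT _ mI); case: hL.
have step : (pdist x N p g g' <= pdist x N p f f' +
    L%:E * (pdist x N p g g' + pdist x N p b b'))%E.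
  pose w := wcomp shift weight (h \_ I).
  rewrite {1}/pdist pnormE.
  have eqg : {ae muI x N, forall t, ((g \- g')%R \_ I) t =
      (((f \- f')%R \_ I) \+ w)%R t}.
    have := ae_muI2 (fun t => @conj _ _) gE gE'.
    move: ae_Iset; apply: ae_muI2 => t tI [{}gE {}gE'].
    rewrite /= !patchE mem_set//= gE gE' !TopE// /w /wcomp !patchE.
    rewrite mem_set/=; last exact: shift_Iset.
    rewrite /h /=; ring.
  rewrite (Lp_size_ae_eq (mu := muI x N)
    (h := (((f \- f') \_ I) \+ w)%R) p0 eqg).
  apply: (le_trans (Lp_sizeD (muI x N) (h := w) p0 _ _)).
  - by apply/(measurable_restrictT _ mI); case: ffL.
  - exact: (measurable_wcomp measurable_shift measurable_weight mh).
  rewrite /pdist pnormE leeD2l//.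
  have wle : (Lp_size (muI x N) p w <=
      (Lp_rate p rho)%:E * Lp_size (muI x N) p (h \_ I))%E.
    apply: (Lp_size_wcomp (mu := muI x N) measurable_shift muI_shift_le
      rho0 ae_weight_le p0 mh).
    by rewrite -pnormE; case: hL.
  rewrite -LE -pnormE in wle; apply: (le_trans wle).
  rewrite lee_wpmul2l ?lee_fin//.
  by apply: pdist_le; [case: ggL|case: bbL].
(* All three distances are finite, so the estimate becomes one between reals, and L times the
   distance of g and g' can be subtracted. *)
move: step; have := pnorm_fin_num ggL; have := pnorm_fin_num ffL.
have := pnorm_fin_num bbL; rewrite -!/(pdist x N p _ _).
move=> /fineK <- /fineK <- /fineK <-.
set D := fine _; set A := fine _; set B := fine _.
rewrite -!EFinM -!EFinD !lee_fin => step.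
rewrite mul1r mulrC ler_pdivlMr ?subr_gt0//; lra.
Qed.

Lemma fstar_dist_le (f f' b b' g g' : R -> R) (A B : R) :
  inLp x N p f -> inLp x N p f' -> inLp x N p b -> inLp x N p b' ->
  is_fstar x N alpha p f b g -> is_fstar x N alpha p f' b' g' ->
  (pdist x N p f f' <= A%:E)%E -> (pdist x N p b b' <= B%:E)%E ->
  (pdist x N p g g' <= (1 / (1 - L) * (A + L * B))%:E)%E.
Proof.
move=> fL fL' bL bL' gE gE' fA bB.
apply: (le_trans (fstar_lipschitz fL fL' bL bL' gE gE')).
rewrite [leRHS]EFinM [(A + _)%:E]EFinD [(L * B)%:E]EFinM lee_wpmul2l ?lee_fin//.
  by rewrite div1r invr_ge0 subr_ge0 ltW// Lambda_p_lt1.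
by rewrite leeD// lee_wpmul2l// lee_fin Lambda_p_ge0.
Qed.

Lemma pdist_diag g : pdist x N p g g = 0%E.
Proof.
rewrite /pdist pnormE (_ : _ \_ I = fun=> 0) ?Lp_size0//.
by apply/funext => t; rewrite patchE /= subrr if_same.
Qed.

Lemma pdist_le_bounds g h (A B : R) : inLp x N p g -> inLp x N p h ->
  (pnorm x N p g <= A%:E)%E -> (pnorm x N p h <= B%:E)%E ->
  (pdist x N p g h <= (A + B)%:E)%E.
Proof.
by move=> [mg _] [mh _] gA hB; rewrite EFinD (le_trans (pdist_le mg mh))// leeD.
Qed.

(** A partner within C bounds the infimum in [pdelta], so partners in both directions bound both
    suprema. *)
Lemma dH_le (H K : set (R -> R)) (C : \bar R) :
  (forall h, H h -> exists2 k, K k & (pdist x N p h k <= C)%E) ->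
  (forall k, K k -> exists2 h, H h & (pdist x N p h k <= C)%E) ->
  (dH x N p H K <= C)%E.
Proof.
move=> HK KH; rewrite /dH ge_max; apply/andP; split;
  apply: ge_ereal_sup => _ [g gH <-].
- have [k kK hk] := HK _ gH; apply: le_trans hk.
  by apply: ereal_inf_lbound; exists k.
- have [h hH hk] := KH _ gH; apply: le_trans hk.
  by apply: ereal_inf_lbound; exists h => //; exact: pdist_sym.
Qed.

(** For base f the difference g - b vanishes at g = f. This makes the distance from f to f * b a
    distance between two fixed points. *)
Lemma is_fstar_diag f : inLp x N p f -> is_fstar x N alpha p f f f.
Proof.
move=> fL; split=> //; apply: aeW => t.
by rewrite /Top big1 ?addr0// => n _; rewrite subrr !mulr0.
Qed.

(** * Distances between fixed points under norm bounds on seeds and bases *)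

Section fstar_bounds.
Variables (f f' b b' : R -> R) (A A' B B' : R).
Hypotheses (fL : inLp x N p f) (fL' : inLp x N p f').
Hypotheses (bL : inLp x N p b) (bL' : inLp x N p b').
Hypotheses (fA : (pnorm x N p f <= A%:E)%E) (fA' : (pnorm x N p f' <= A'%:E)%E).
Hypotheses (bB : (pnorm x N p b <= B%:E)%E) (bB' : (pnorm x N p b' <= B'%:E)%E).
Let st := fstar x N alpha p.

Let pdist_diag_le g : (pdist x N p g g <= 0%:E)%E.
Proof. by rewrite pdist_diag. Qed.

Lemma pdist_seed_fstar :
  (pdist x N p f (st f b) <= (L / (1 - L) * (A + B))%:E)%E.
Proof.
(* As f = f * f, the seeds agree, whence the 0, and the bases f and b are at most A + B apart. *)
have -> : L / (1 - L) * (A + B) = 1 / (1 - L) * (0 + L * (A + B)) by ring.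
by apply: (fstar_dist_le fL fL fL bL (is_fstar_diag fL) (fstarP fL bL) _
  (pdist_le_bounds fL bL fA bB)).
Qed.

Lemma pdist_base_fstar :
  (pdist x N p b (st f b) <= (1 / (1 - L) * (B + A))%:E)%E.
Proof.
(* As b = b * b, the bases agree and the seeds b and f are at most B + A apart. *)
have -> : 1 / (1 - L) * (B + A) = 1 / (1 - L) * ((B + A) + L * 0) by ring.
by apply: (fstar_dist_le bL fL bL bL (is_fstar_diag bL) (fstarP fL bL)
  (pdist_le_bounds bL fL bB fA)).
Qed.

Lemma pdist_fstar_seeds :
  (pdist x N p (st f b) (st f' b) <= (1 / (1 - L) * (A + A'))%:E)%E.
Proof.
have -> : 1 / (1 - L) * (A + A') = 1 / (1 - L) * ((A + A') + L * 0) by ring.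
by apply: (fstar_dist_le fL fL' bL bL (fstarP fL bL) (fstarP fL' bL)
  (pdist_le_bounds fL fL' fA fA')).
Qed.

Lemma pdist_fstar_bases :
  (pdist x N p (st f b) (st f b') <= (L / (1 - L) * (B + B'))%:E)%E.
Proof.
have -> : L / (1 - L) * (B + B') = 1 / (1 - L) * (0 + L * (B + B')) by ring.
by apply: (fstar_dist_le fL fL bL bL' (fstarP fL bL) (fstarP fL bL') _
  (pdist_le_bounds bL bL' bB bB')).
Qed.

Lemma pdist_fstar : (pdist x N p (st f b) (st f' b') <=
  (1 / (1 - L) * ((A + A') + L * (B + B')))%:E)%E.
Proof.
exact: (fstar_dist_le fL fL' bL bL' (fstarP fL bL) (fstarP fL' bL')
  (pdist_le_bounds fL fL' fA fA') (pdist_le_bounds bL bL' bB bB')).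
Qed.

End fstar_bounds.
End partition.

(** * The seven Hausdorff estimates *)

Unset Implicit Arguments.

Theorem theorem5p2 (R : realType) (N : nat) (x : nat -> R)
    (alpha : nat -> R -> R) (p : \bar R)
    (F F' B B' : set (R -> R)) (MF MF' MB MB' : R) (f b : R -> R) :
  (2 <= N)%N ->
  (forall i, (i < N)%N -> x i < x i.+1) ->
  (forall n, (1 <= n <= N)%N -> measurable_fun (Iset x N) (alpha n)) ->
  (Lambda x N alpha < 1)%E ->
  (0 < p)%E ->
  F !=set0 -> F' !=set0 -> B !=set0 -> B' !=set0 ->
  Lp_compact x N p F -> Lp_compact x N p F' ->
  Lp_compact x N p B -> Lp_compact x N p B' ->
  (forall g, F g -> (pnorm x N p g <= MF%:E)%E) ->
  (forall g, F' g -> (pnorm x N p g <= MF'%:E)%E) ->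
  (forall g, B g -> (pnorm x N p g <= MB%:E)%E) ->
  (forall g, B' g -> (pnorm x N p g <= MB'%:E)%E) ->
  inLp x N p f -> inLp x N p b ->
  let L := Lambda_p x N alpha p in
  (dH x N p F (starFb x N alpha p F b)
         <= (L / (1 - L))%:E * (MF%:E + pnorm x N p b))%E /\
      (dH x N p B (starfB x N alpha p f B)
         <= (1 / (1 - L))%:E * (MB%:E + pnorm x N p f))%E /\
      (dH x N p F (starFB x N alpha p F B)
         <= (L / (1 - L) * (MF + MB))%:E)%E /\
      (dH x N p B (starFB x N alpha p F B)
         <= (1 / (1 - L) * (MB + MF))%:E)%E /\
      (dH x N p (starFB x N alpha p F B) (starFB x N alpha p F' B)
         <= (1 / (1 - L) * (MF + MF'))%:E)%E /\
      (dH x N p (starFB x N alpha p F B) (starFB x N alpha p F B')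
         <= (L / (1 - L) * (MB + MB'))%:E)%E /\
      (dH x N p (starFB x N alpha p F B) (starFB x N alpha p F' B')
         <= (1 / (1 - L) * ((MF + MF') + L * (MB + MB')))%:E)%E.
Proof.
move=> N2 xlt malpha Lam1 p0 [f1 Ff1] [f2 Ff2] [b1 Bb1] [b2 Bb2].
move=> [FL _] [FL' _] [BL _] [BL' _] FM FM' BM BM' fL bL L.
(* The norms of f and b are finite and serve as their own real bounds. *)
have fE : pnorm x N p f = (fine (pnorm x N p f))%:E.
  by rewrite fineK// pnorm_fin_num.
have bE : pnorm x N p b = (fine (pnorm x N p b))%:E.
  by rewrite fineK// pnorm_fin_num.
have fle : (pnorm x N p f <= (fine (pnorm x N p f))%:E)%E by rewrite -fE.
have ble : (pnorm x N p b <= (fine (pnorm x N p b))%:E)%E by rewrite -bE.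
do 6?split.
- rewrite bE -EFinD -EFinM; apply: dH_le => // [h Fh|_ [h Fh <-]].
    exists (fstar x N alpha p h b); first by exists h.
    by apply: pdist_seed_fstar => //; [exact: FL|exact: FM].
  by exists h => //; apply: pdist_seed_fstar => //; [exact: FL|exact: FM].
- rewrite fE -EFinD -EFinM; apply: dH_le => // [h Bh|_ [h Bh <-]].
    exists (fstar x N alpha p f h); first by exists h.
    by apply: pdist_base_fstar => //; [exact: BL|exact: BM].
  by exists h => //; apply: pdist_base_fstar => //; [exact: BL|exact: BM].
- apply: dH_le => // [h Fh|_ [h Fh [c Bc <-]]].
    (* Any base b1 in B gives a partner of h, as the bound depends on norms only. *)
    exists (fstar x N alpha p h b1); first by exists h => //; exists b1.
    by apply: pdist_seed_fstar; auto.
  by exists h => //; apply: pdist_seed_fstar; auto.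
- apply: dH_le => // [c Bc|_ [h Fh [c Bc <-]]].
    exists (fstar x N alpha p f1 c); first by exists f1 => //; exists c.
    by apply: pdist_base_fstar; auto.
  by exists c => //; apply: pdist_base_fstar; auto.
- apply: dH_le => // _ [h Fh [c Bc <-]].
    (* The partner keeps the base c and takes an arbitrary seed from the other set. *)
    exists (fstar x N alpha p f2 c); first by exists f2 => //; exists c.
    by apply: pdist_fstar_seeds; auto.
  exists (fstar x N alpha p f1 c); first by exists f1 => //; exists c.
  by apply: pdist_fstar_seeds; auto.
- apply: dH_le => // _ [h Fh [c Bc <-]].
    exists (fstar x N alpha p h b2); first by exists h => //; exists b2.
    by apply: pdist_fstar_bases; auto.
  exists (fstar x N alpha p h b1); first by exists h => //; exists b1.
  by apply: pdist_fstar_bases; auto.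
- apply: dH_le => // _ [h Fh [c Bc <-]].
    (* Seed and base are both exchanged: one fixed element of each set is a partner for all of the
       other. *)
    exists (fstar x N alpha p f2 b2); first by exists f2 => //; exists b2.
    by apply: pdist_fstar; auto.
  exists (fstar x N alpha p f1 b1); first by exists f1 => //; exists b1.
  by apply: pdist_fstar; auto.
Qed.
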